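(* Let $F$ be a field with $\operatorname{char}(F)\neq 2$, and let $h=2+\eta[-1]\in K^{MW}_0(F)$. As a set, the homogeneous spectrum of the Milnor-Witt $K$-theory ring of $F$ is the disjoint union $$\operatorname{Spec}^h(K^{MW}_*(F))=A\amalg B\amalg C\amalg D\amalg \{([F^\times], 2),\ ([F^\times],\eta),\ ([F^\times],2,\eta)\},$$ where \begin{align*} A&=\{([P_\alpha], h): \alpha \text{ an ordering on }F\},\\ B&=\{([P_\alpha], 2, \eta): \alpha\text{ an ordering on }F\},\\ C&=\{([P_\alpha], h, p): \alpha\text{ an ordering on }F,\ p\text{ an odd prime}\},\\ D&=\{([F^{\times}], \eta, p): p\text{ an odd prime}\}. \end{align*} Topologically, $A\cong B\cong X_F$ (homeomorphisms, with $A$ and $B$ given the subspace topology from $\operatorname{Spec}^h(K^{MW}_*(F))$), where $X_F$ is the space of orderings on $F$ with the Harrison topology.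
   Context: For a subset $S\subseteq F^\times$, $[S]=\{[s]:s\in S\}$ is a set of formal symbols. The Milnor-Witt $K$-theory $K^{MW}_*(F)$ is the quotient of the free associative (unital) $\mathbb{Z}$-algebra on the set $[F^\times]\cup\{\eta\}$ by the two-sided ideal generated by: (1) $[ab]-[a]-[b]-\eta[a][b]$ for $a,b\in F^\times$; (2) $[a][b]$ for $a,b\in F^\times$ with $a+b=1$; (3) $[a]\eta-\eta[a]$ for $a\in F^\times$; (4) $(2+[-1]\eta)\eta$. It is $\mathbb{Z}$-graded with $\eta$ in degree $-1$ and $[a]$ in degree $1$. It is $\epsilon$-commutative with $\epsilon=-(1+\eta[-1])$, i.e. $ab=\epsilon^{m+n}ba$ as printed in the paper's convention for homogeneous $a,b$ of degrees $m,n$ (this convention is not needed to parse the claim). $\operatorname{Spec}^h(K^{MW}_*(F))$ is the set of prime ideals generated by homogeneous elements (prime: a proper two-sided ideal $J$ such that $ab\in J$ implies $a\in J$ or $b\in J$), with the Zariski topology generated by the subbasis of sets $D(q)=\{J: q\notin J\}$, $q\in K^{MW}_*(F)$. A list in parentheses, such as $([P_\alpha],h,p)$, denotes the ideal of $K^{MW}_*(F)$ generated by the listed elements and by all elements of the listed sets. An ordering on $F$ is viewed as a surjective group homomorphism $\alpha:F^\times\to\{\pm1\}$ such that whenever $\alpha(a)=\alpha(b)=1$ one has $a+b\neq 0$ and $\alpha(a+b)=1$. Its positive cone is $P_\alpha=\{a\in F^\times:\alpha(a)=1\}$. $X_F$ is the (possibly empty) set of orderings on $F$; the Harrison topology on $X_F$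 is the subspace topology induced by the product topology on $\{\pm1\}^{F^\times}$ (with $\{\pm 1\}$ discrete). *)

(* Defs.v *)
From HB Require Import structures.
From mathcomp Require Import all_boot all_order all_algebra.
From mathcomp Require Import all_classical topology.
From mathcomp Require Import monalg.

Set Implicit Arguments.
Unset Strict Implicit.
Unset Printing Implicit Defensive.

Import GRing.Theory.
Local Open Scope classical_set_scope.
Local Open Scope ring_scope.
Local Open Scope quotient_scope.

Section TwoSidedIdeals.
Variable R : pzRingType.

Definition two_sided_ideal (J : set R) : Prop :=
  [/\ J 0, forall x y, J x -> J y -> J (x - y) &
      forall a x, J x -> J (a * x) /\ J (x * a)].

Definition ideal_gen (S : set R) : set R := smallest two_sided_ideal S.

Definition prime_ideal (J : set R) : Prop :=
  [/\ two_sided_ideal J, J <> setT & forall a b, J (a * b) -> J a \/ J b].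

Lemma ideal_gen_ideal (S : set R) : two_sided_ideal (ideal_gen S).
Proof.
split=> [J [[]] //|x y Jx Jy J JP|a x Jx].
  by have [[_ JB _] _] := JP; apply: JB; [exact: Jx|exact: Jy].
by split=> J JP; have [[_ _ JM] _] := JP; have [] := JM a x (Jx J JP).
Qed.

Lemma sub_ideal_gen (S : set R) : S `<=` ideal_gen S.
Proof. by move=> x Sx J [_]; apply. Qed.

(* ring_quotient only makes quotients of commutative rings into rings; here   *)
(* its additive quotient is given the multiplication of a two-sided quotient. *)
Variable S : set R.

Definition ideal_gen_pred : {pred R} := fun x => `[< ideal_gen S x >].

Lemma ideal_gen_zmod : zmod_closed ideal_gen_pred.
Proof.
have [J0 JB _] := ideal_gen_ideal S.
split=> [|x y]; first exact/asboolP.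
by move=> /asboolP Jx /asboolP Jy; apply/asboolP; exact: JB.
Qed.

HB.instance Definition _ :=
  GRing.isZmodClosed.Build R ideal_gen_pred ideal_gen_zmod.

Definition quot_ring : Type := Quotient.quot ideal_gen_pred.

HB.instance Definition _ := GRing.Zmodule.on quot_ring.

Definition quot_proj (x : R) : quot_ring := \pi_(Quotient.quot ideal_gen_pred) x.

Definition quot_repr (x : quot_ring) : R :=
  repr (x : Quotient.quot ideal_gen_pred).

Lemma quot_reprK : cancel quot_repr quot_proj.
Proof. by move=> x; exact: reprK. Qed.

Lemma quot_projP (x y : R) :
  quot_proj x = quot_proj y <-> ideal_gen S (x - y).
Proof.
have E := Quotient.idealrBE ideal_gen_pred x y.
by split=> [/eqP|/asboolP] H; [apply/asboolP|apply/eqP]; move: E H => <-.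
Qed.

Lemma quot_proj_is_zmod_morphism : zmod_morphism quot_proj.
Proof. by move=> x y; rewrite /quot_proj !piE. Qed.

HB.instance Definition _ :=
  GRing.isZmodMorphism.Build R quot_ring quot_proj quot_proj_is_zmod_morphism.

Definition quot_one : quot_ring := quot_proj 1.
Definition quot_mul : quot_ring -> quot_ring -> quot_ring :=
  lift_op2 (Quotient.quot ideal_gen_pred) *%R.

Lemma quot_projM : {morph quot_proj : x y / x * y >-> quot_mul x y}.
Proof.
have [_ JB JM] := ideal_gen_ideal S.
move=> x y; unlock quot_mul; apply/quot_projP.
set x' := quot_repr (quot_proj x); set y' := quot_repr (quot_proj y).
have Jx : ideal_gen S (x' - x) by apply/quot_projP; exact: quot_reprK.
have Jy : ideal_gen S (y - y') by apply/quot_projP; exact/esym/quot_reprK.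
rewrite (_ : _ - _ = x * (y - y') - (x' - x) * y'); last first.
  by rewrite mulrBr mulrBl opprB addrA subrK.
by apply: JB; [exact: (JM _ _ Jy).1|exact: (JM _ _ Jx).2].
Qed.

Lemma quot_mulA : associative quot_mul.
Proof.
move=> x y z; rewrite -[x]quot_reprK -[y]quot_reprK -[z]quot_reprK.
by rewrite -!quot_projM mulrA.
Qed.

Lemma quot_mul1l : left_id quot_one quot_mul.
Proof. by move=> x; rewrite -[x]quot_reprK -quot_projM mul1r. Qed.

Lemma quot_mul1r : right_id quot_one quot_mul.
Proof. by move=> x; rewrite -[x]quot_reprK -quot_projM mulr1. Qed.

Lemma quot_mulDl : left_distributive quot_mul +%R.
Proof.
move=> x y z; rewrite -[x]quot_reprK -[y]quot_reprK -[z]quot_reprK.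
by rewrite -raddfD -!quot_projM -raddfD mulrDl.
Qed.

Lemma quot_mulDr : right_distributive quot_mul +%R.
Proof.
move=> x y z; rewrite -[x]quot_reprK -[y]quot_reprK -[z]quot_reprK.
by rewrite -raddfD -!quot_projM -raddfD mulrDr.
Qed.

HB.instance Definition _ := GRing.Zmodule_isPzRing.Build quot_ring
  quot_mulA quot_mul1l quot_mul1r quot_mulDl quot_mulDr.

Lemma quot_proj_is_monoid_morphism : monoid_morphism quot_proj.
Proof. by split=> // x y; rewrite quot_projM. Qed.

HB.instance Definition _ := GRing.isMonoidMorphism.Build R quot_ring quot_proj
  quot_proj_is_monoid_morphism.

End TwoSidedIdeals.

Section MilnorWitt.
Variable F : fieldType.

Definition Fx : Type := {x : F | x != 0}.
HB.instance Definition _ := Choice.on Fx.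

Definition mkFx (x : F) (nz : x != 0) : Fx := exist _ x nz.

Definition fx_mul (a b : Fx) : Fx := mkFx (mulf_neq0 (svalP a) (svalP b)).

Lemma m1_neq0 : (-1 : F) != 0. Proof. by rewrite oppr_eq0 oner_neq0. Qed.

Definition fx_m1 : Fx := mkFx m1_neq0.

(* Generators: Some a is the symbol [a], None is eta. *)
Definition kmw_gen : Type := option Fx.
HB.instance Definition _ := Choice.on kmw_gen.

(* The monoid algebra of a free monoid is the free associative algebra. *)
Definition kmw_free : nzRingType := {malg int[{fmonom kmw_gen}]}.

Definition free_gen (g : kmw_gen) : kmw_free := mkmalgU (fmu g) (1 : int).

Local Notation sym a := (free_gen (Some a)).
Local Notation eta := (free_gen None).

Definition kmw_rel : set kmw_free :=
  [set r | exists a b : Fx,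
     r = sym (fx_mul a b) - sym a - sym b - eta * sym a * sym b] `|`
  [set r | exists a b : Fx, sval a + sval b = 1 /\ r = sym a * sym b] `|`
  [set r | exists a : Fx, r = sym a * eta - eta * sym a] `|`
  [set (2%:R + sym fx_m1 * eta) * eta].

Definition KMW : Type := quot_ring kmw_rel.
HB.instance Definition _ := GRing.PzRing.on KMW.
HB.instance Definition _ := isPointed.Build KMW 0.

Definition kmw_proj : kmw_free -> KMW := @quot_proj kmw_free kmw_rel.
HB.instance Definition _ :=
  GRing.RMorphism.copy kmw_proj (@quot_proj kmw_free kmw_rel).

Definition kmw_sym (a : Fx) : KMW := kmw_proj (sym a).
Definition kmw_eta : KMW := kmw_proj eta.

Definition gen_deg (g : kmw_gen) : int := if g is Some _ then 1 else -1.

Definition word_deg (w : {fmonom kmw_gen}) : int :=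
  \sum_(g <- (w : seq kmw_gen)) gen_deg g.

Definition free_homog (n : int) : set kmw_free :=
  [set x | forall w : {fmonom kmw_gen}, mcoeff w x <> 0 -> word_deg w = n].

(* kmw_rel is homogeneous, so the grading descends to the quotient.           *)
Definition kmw_graded (n : int) : set KMW := kmw_proj @` free_homog n.

Definition homogeneous (x : KMW) : Prop := exists n, kmw_graded n x.

Definition homog_ideal (J : set KMW) : Prop :=
  exists2 S : set KMW, S `<=` homogeneous & J = ideal_gen S.

Definition spech : set (set KMW) :=
  [set J | prime_ideal J /\ homog_ideal J].

Definition Spech : Type := set_type spech.
HB.instance Definition _ := Choice.on Spech.
HB.instance Definition _ := @isSubBaseTopological.Build Spech
  KMW setT (fun q => [set J : Spech | ~ set_val J q]).

Definition kmw_h : KMW := 2%:R + kmw_eta * kmw_sym fx_m1.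

(* {1, -1} is encoded as bool, with b standing for (-1) ^+ b: false is 1,     *)
(* true is -1 and addb is the multiplication.                                 *)
Definition is_ordering (alpha : Fx -> bool) : Prop :=
  [/\ range alpha = setT,
      forall a b, alpha (fx_mul a b) = alpha a (+) alpha b &
      forall a b, alpha a = false -> alpha b = false ->
        exists nz : sval a + sval b != 0, alpha (mkFx nz) = false].

Definition orderings : set {ptws Fx -> bool} :=
  [set alpha : {ptws Fx -> bool} | is_ordering alpha].

Definition X_ : Type := set_type orderings.
HB.instance Definition _ := Topological.on X_.

Definition pos_cone (alpha : Fx -> bool) : set Fx :=
  [set a | alpha a = false].

Definition symbols (S : set Fx) : set KMW := kmw_sym @` S.

Definition spech_A : set (set KMW) :=
  [set J | exists2 alpha, is_ordering alpha &
     J = ideal_gen (symbols (pos_cone alpha) `|` [set kmw_h])].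

Definition spech_B : set (set KMW) :=
  [set J | exists2 alpha, is_ordering alpha &
     J = ideal_gen (symbols (pos_cone alpha) `|` [set 2%:R; kmw_eta])].

Definition spech_C : set (set KMW) :=
  [set J | exists alpha, exists p : nat,
     [/\ is_ordering alpha, prime p, odd p &
     J = ideal_gen (symbols (pos_cone alpha) `|` [set kmw_h; p%:R])]].

Definition spech_D : set (set KMW) :=
  [set J | exists p : nat, [/\ prime p, odd p &
     J = ideal_gen (symbols setT `|` [set kmw_eta; p%:R])]].

Definition ideal_2 : set KMW := ideal_gen (symbols setT `|` [set 2%:R]).
Definition ideal_eta : set KMW := ideal_gen (symbols setT `|` [set kmw_eta]).
Definition ideal_2_eta : set KMW :=
  ideal_gen (symbols setT `|` [set 2%:R; kmw_eta]).

(* The part of X lying in Spec^h, with the subspace topology. *)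
Definition subspech (X : set (set KMW)) : topologicalType :=
  set_type [set J : Spech | X (set_val J)].

End MilnorWitt.

Arguments spech F : clear implicits.
Arguments spech_A F : clear implicits.
Arguments spech_B F : clear implicits.
Arguments spech_C F : clear implicits.
Arguments spech_D F : clear implicits.
Arguments ideal_2 F : clear implicits.
Arguments ideal_eta F : clear implicits.
Arguments ideal_2_eta F : clear implicits.

Definition is_disjoint_union (T : Type) (X : set T) (s : seq (set T)) : Prop :=
  X = \bigcup_(i in `I_(size s)) nth set0 s i /\
  trivIset `I_(size s) (nth set0 s).

Definition homeomorphic (X Y : topologicalType) : Prop :=
  exists (f : X -> Y) (g : Y -> X),
    [/\ cancel f g, cancel g f, continuous f & continuous g].

(* Main.v *)
From HB Require Import structures.
Require Import Defs.
From mathcomp Require Import all_boot all_order all_algebra.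
From mathcomp Require Import all_classical topology.
From mathcomp Require Import finmap monalg.
From mathcomp Require Import zify ring.

(** Write rho for [-1] and let J be a homogeneous prime of the Milnor-Witt
    ring.

    Classification.  The relation [a][-a] = 0 puts one of [a], [-a] into J for
    every a.  If rho is not in J, exactly one of them lies in J, and the units a
    with [a] in J are the positive cone of an ordering: they are closed under
    products because [ab] = [a] + [b] + eta [a][b], and closed under sums by the
    Steinberg relation applied to a/c + b/c = 1.  Moreover rho h = [1] = 0 forces
    h into J.  If rho is in J, then so is every [a].  In both cases J contains
    an ideal I modulo which every [a] is 0 or rho and eta rho is an integer, so
    that the degree n part of the quotient by I is generated by rho ^ n, or by
    eta ^ (- n) if n is negative (homog_reduce).  A homogeneous element of J is
    then, modulo I, an integer times a power of rho or of eta, and primality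
    splits it.  Hence J is determined by the ordering (if there is one), by the
    integers it contains, and by whether it contains rho and eta
    (homog_prime_eq).  The relations eta h = 0 and rho h = 0 exclude the
    combinations missing from the list (spech_classification).

    Each listed ideal is a prime.  Let k be a field.  Elements s(a) and e of k
    that satisfy the defining relations in the roles of [a] and eta give a ring
    morphism to the rational functions k(t), sending [a] to s(a) t and eta to
    e / t: the indeterminate records the degree.  If I is one of the listed
    ideals, contained in the kernel of such a morphism, the normal form modulo I
    and the linear independence of the powers of t show that I is the whole
    kernel (ideal_eq_kernel), so it is prime.  An ordering provides s = 0 on
    positive and 1 on negative units, with e = - 2; the ideals containing all
    the symbols come from s = 0.  The field k is the field of rational numbers
    or a prime field.  The same morphisms decide which of rho, eta and the
    integers lie in a listed ideal, and this separates the families.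

    Topology.  The ordering is recovered from the ideal by the test whether [a]
    lies in it; since exactly one of [a] and [-a] does, both outcomes of the test
    are open conditions.  Conversely the image of a fixed element of the
    ring in k(t) involves only finitely many signs, so the ideal depends
    continuously on the ordering (ordering_family_homeomorphic). *)

Set Implicit Arguments.
Unset Strict Implicit.
Unset Printing Implicit Defensive.

Import Order.TTheory GRing.Theory Num.Theory.
Local Open Scope classical_set_scope.
Local Open Scope ring_scope.

(** * Two-sided ideals and prime ideals *)

Section Ideals.
Variables (R : pzRingType) (J : set R).
Hypothesis idJ : two_sided_ideal J.

Lemma ideal_zero : J 0. Proof. by case: idJ. Qed.

Lemma ideal_sub x y : J x -> J y -> J (x - y).
Proof. by case: idJ => _ + _; apply. Qed.

Lemma ideal_opp x : J x -> J (- x).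
Proof. by move=> Jx; rewrite -sub0r; apply: ideal_sub Jx; exact: ideal_zero. Qed.

Lemma ideal_add x y : J x -> J y -> J (x + y).
Proof. by move=> Jx Jy; rewrite -[y]opprK; apply: ideal_sub => //; exact: ideal_opp. Qed.

Lemma ideal_mulL a x : J x -> J (a * x).
Proof. by move=> Jx; case: idJ => _ _ /(_ a x Jx)[]. Qed.

Lemma ideal_mulR a x : J x -> J (x * a).
Proof. by move=> Jx; case: idJ => _ _ /(_ a x Jx)[]. Qed.

Lemma ideal_mulz x c : J x -> J (x *~ c).
Proof. by move=> Jx; rewrite -mulrzr; exact: ideal_mulR. Qed.

Lemma ideal_sum (I : Type) (r : seq I) (P : pred I) (f : I -> R) :
  (forall i, P i -> J (f i)) -> J (\sum_(i <- r | P i) f i).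
Proof. by move=> Jf; elim/big_ind: _ => //; [exact: ideal_zero|exact: ideal_add]. Qed.

Lemma ideal_cong x y : J (x - y) -> J x <-> J y.
Proof.
move=> Jxy; split=> [Jx|Jy].
  by rewrite -[y](subKr x); exact: ideal_sub.
by rewrite -[x](subrK y); exact: ideal_add.
Qed.

Lemma ideal_cong_trans x y z : J (x - y) -> J (y - z) -> J (x - z).
Proof. by move=> Jxy /(ideal_add Jxy); rewrite addrA subrK. Qed.

Lemma ideal_gen_min (S : set R) : S `<=` J -> ideal_gen S `<=` J.
Proof. by move=> SJ x; apply. Qed.

End Ideals.

Section PrimeIdeals.
Variables (R : pzRingType) (J : set R).
Hypothesis prJ : prime_ideal J.

Lemma prime_ideal_ideal : two_sided_ideal J. Proof. by case: prJ. Qed.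

Lemma prime_ideal1 : ~ J 1.
Proof.
case: prJ => idJ JT _ J1; apply: JT; rewrite predeqE => x; split=> // _.
by rewrite -[x]mulr1; exact: ideal_mulL.
Qed.

Lemma prime_idealM x y : J (x * y) -> J x \/ J y.
Proof. by case: prJ => _ _; apply. Qed.

Lemma prime_idealX x n : J (x ^+ n) -> J x.
Proof.
elim: n => [/prime_ideal1//|n IH]; rewrite exprS => /prime_idealM[//|].
exact: IH.
Qed.

(** The preimage of a prime ideal in the ring of integers is prime, hence zero or
    generated by a prime number. *)
Lemma prime_ideal_char :
  (forall c : int, J c%:~R -> c = 0) \/
  (exists2 p, prime p & forall c : int, J c%:~R <-> (p %| c)%Z).
Proof.
have idJ := prime_ideal_ideal.
have [[c Jc c0]|no] := pselect (exists2 c : int, J c%:~R & c != 0); last first.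
  by left=> c Jc; apply/eqP/negPn/negP => c0; apply: no; exists c.
right.
have [p p_pr Jp] : exists2 p, prime p & J p%:R.
  have Jn : J (`|c|%N)%:R.
    case: c {c0} Jc => n Jn; first exact: Jn.
    by rewrite -[_%:R]opprK; apply: ideal_opp.
  move: Jn; have : (0 < `|c|)%N by rewrite absz_gt0.
  elim/ltn_ind: `|c|%N => n IH n0 Jn; case: (ltnP 1 n) => [n1|n1]; last first.
    by move: Jn; rewrite (_ : n = 1%N); [move/prime_ideal1|apply/eqP; rewrite eqn_leq n1].
  have dn := pdiv_dvd n.
  move: Jn; rewrite -(divnK dn) natrM => /prime_idealM[Jq|Jp].
    apply: IH Jq; first by rewrite ltn_Pdiv // prime_gt1 // pdiv_prime.
    by rewrite divn_gt0 ?pdiv_gt0 // dvdn_leq.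
  by exists (pdiv n) => //; exact: pdiv_prime.
exists p => // d; split=> [Jd|/dvdzP[q ->]]; last first.
  by rewrite intrM; apply: ideal_mulL.
apply/negPn/negP => pd; case: prime_ideal1.
have cop : coprimez p d.
  by rewrite /coprimez /gcdz /= eqz_nat -/(coprime _ _) prime_coprime.
have [u [v uv]] := Bezoutz p d; move: cop; rewrite /coprimez -uv => /eqP E.
rewrite -(mulr1z 1) -E rmorphD !rmorphM /=.
by apply: ideal_add => //; exact: ideal_mulL.
Qed.

End PrimeIdeals.

(** * Ring morphisms from the Milnor-Witt ring to rational functions *)

Section FreeEval.
Variables (F : fieldType) (T : comNzRingType) (v : kmw_gen F -> T).

Definition word_val (w : {fmonom (kmw_gen F)}) : T := \prod_(g <- (w : seq _)) v g.

(** Together with the coefficients, the multiplicativity of word_val is the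
    universal property of the free algebra for commutative targets. *)
Lemma word_val_mmorphism : mmorphism word_val.
Proof.
by split=> [x y|]; rewrite /word_val ?fmM ?fm1 ?big_cat ?big_nil.
Qed.

HB.instance Definition _ := isMultiplicative.Build _ T word_val word_val_mmorphism.

Definition free_eval : kmw_free F -> T := mmap (intmul 1) word_val.

HB.instance Definition _ := GRing.RMorphism.copy free_eval
  (mmap (intmul 1 : {rmorphism int -> T}) (word_val : {mmorphism _ -> T})).

Lemma free_eval_gen g : free_eval (free_gen g) = v g.
Proof.
by rewrite /free_eval /free_gen mmapU mul1r /word_val fmU big_seq1.
Qed.

Lemma free_evalB : {morph free_eval : x y / x - y}.
Proof. exact: rmorphB. Qed.

Lemma free_evalM : {morph free_eval : x y / x * y}.
Proof. exact: rmorphM. Qed.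

Lemma free_eval_comm x y : free_eval (x * y - y * x) = 0.
Proof.
rewrite free_evalB; apply/eqP; rewrite subr_eq0; apply/eqP.
exact: etrans (free_evalM x y) (etrans (mulrC _ _) (esym (free_evalM y x))).
Qed.

Lemma free_eval_ideal_gen : (forall r, kmw_rel r -> free_eval r = 0) ->
  forall y, ideal_gen (@kmw_rel F) y -> free_eval y = 0.
Proof.
move=> v0; have : two_sided_ideal [set y | free_eval y = 0].
  split=> [|x y /= x0 y0|a x /= x0] /=; first by rewrite rmorph0.
    by rewrite free_evalB x0 y0 subr0.
  by split; rewrite free_evalM x0 (mulr0, mul0r).
by move=> /ideal_gen_min; apply.
Qed.

End FreeEval.

Lemma symM_rel (L : fieldType) (x y e t : L) : t != 0 ->
  (x + y + e * x * y) * t - x * t - y * t - e / t * (x * t) * (y * t) = 0.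
Proof. by move=> t0; field. Qed.

Section Points.
Variables (F : fieldType) (k : fieldType).

(** The values in k that [a] and eta must take for the relations to hold after t is
    set to 1.  Since the relations are homogeneous, they also hold for the values
    s(a) t and e / t in k(t). *)
Record kmw_point := KmwPoint {
  pt_sym : Fx F -> k;
  pt_eta : k;
  pt_symM : forall a b,
    pt_sym (fx_mul a b) = pt_sym a + pt_sym b + pt_eta * pt_sym a * pt_sym b;
  pt_steinberg : forall a b, sval a + sval b = 1 -> pt_sym a * pt_sym b = 0;
  pt_hyperbolic : (2%:R + pt_sym (fx_m1 F) * pt_eta) * pt_eta = 0 }.

Local Notation T := {fraction {poly k}}.

Definition indet : T := tofrac 'X.
Definition kconst (c : k) : T := tofrac c%:P.

HB.instance Definition _ := GRing.RMorphism.copy kconst (@tofrac _ \o @polyC k).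

Lemma indet_neq0 : indet != 0.
Proof. by rewrite tofrac_eq0 polyX_eq0. Qed.

Lemma kconst_eq0 c : (kconst c == 0) = (c == 0).
Proof. by rewrite tofrac_eq0 polyC_eq0. Qed.

Variable P : kmw_point.

Definition gen_val (g : kmw_gen F) : T :=
  if g is Some a then kconst (pt_sym P a) * indet else kconst (pt_eta P) / indet.

Lemma free_eval_rel r : kmw_rel r -> free_eval gen_val r = 0.
Proof.
have cK : indet / indet = 1 by rewrite divff // indet_neq0.
case=> [[[|]|]|].
- move=> [a [b ->]]; rewrite !(rmorphB, rmorphM) /= !free_eval_gen /= pt_symM.
  rewrite !(rmorphD, rmorphM) /=; exact: symM_rel indet_neq0.
- move=> [a [b [ab ->]]]; rewrite rmorphM /= !free_eval_gen /= mulrACA -rmorphM.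
  by rewrite pt_steinberg // rmorph0 mul0r.
- by move=> [a ->]; exact: free_eval_comm.
- move=> ->; rewrite rmorphM rmorphD rmorph_nat rmorphM /= !free_eval_gen /=.
  rewrite mulrACA cK mulr1 mulrA.
  have := congr1 kconst (pt_hyperbolic P).
  by rewrite !(rmorphD, rmorphM, rmorph_nat, rmorph0) /= => ->; rewrite mul0r.
Qed.

Definition kmw_eval (x : KMW F) : T := free_eval gen_val (quot_repr x).

Lemma kmw_eval_proj y : kmw_eval (kmw_proj y) = free_eval gen_val y.
Proof.
apply/eqP; rewrite -subr_eq0 -rmorphB; apply/eqP.
apply: (free_eval_ideal_gen free_eval_rel); apply/quot_projP.
exact: quot_reprK.
Qed.

Lemma kmw_projK (x : KMW F) : exists y, x = kmw_proj y.
Proof. by exists (quot_repr x); rewrite [RHS]quot_reprK. Qed.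

Lemma kmw_eval_zmod : zmod_morphism kmw_eval.
Proof.
move=> x y; have [x' ->] := kmw_projK x; have [y' ->] := kmw_projK y.
by rewrite -rmorphB !kmw_eval_proj rmorphB.
Qed.

Lemma kmw_eval_monoid : monoid_morphism kmw_eval.
Proof.
split=> [|x y]; first by rewrite -(rmorph1 (@kmw_proj F)) kmw_eval_proj rmorph1.
have [x' ->] := kmw_projK x; have [y' ->] := kmw_projK y.
by rewrite -rmorphM !kmw_eval_proj rmorphM.
Qed.

HB.instance Definition _ := GRing.isZmodMorphism.Build _ _ kmw_eval kmw_eval_zmod.
HB.instance Definition _ := GRing.isMonoidMorphism.Build _ _ kmw_eval kmw_eval_monoid.

Lemma kmw_eval_sym a : kmw_eval (kmw_sym a) = kconst (pt_sym P a) * indet.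
Proof. by rewrite kmw_eval_proj free_eval_gen. Qed.

Lemma kmw_eval_eta : kmw_eval (kmw_eta F) = kconst (pt_eta P) / indet.
Proof. by rewrite kmw_eval_proj free_eval_gen. Qed.

Lemma kmw_eval_int (c : int) : kmw_eval c%:~R = kconst c%:~R.
Proof. by rewrite !rmorph_int. Qed.

Lemma kmw_eval_sym_eq0 a : kmw_eval (kmw_sym a) = 0 <-> pt_sym P a = 0.
Proof.
rewrite kmw_eval_sym; split=> [/eqP|->]; last by rewrite rmorph0 mul0r.
by rewrite mulf_eq0 (negPf indet_neq0) orbF kconst_eq0 => /eqP.
Qed.

Lemma kmw_eval_eta_eq0 : kmw_eval (kmw_eta F) = 0 <-> pt_eta P = 0.
Proof.
rewrite kmw_eval_eta; split=> [/eqP|->]; last by rewrite rmorph0 mul0r.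
by rewrite mulf_eq0 invr_eq0 (negPf indet_neq0) orbF kconst_eq0 => /eqP.
Qed.

Lemma kmw_eval_int_eq0 (c : int) : kmw_eval c%:~R = 0 <-> c%:~R = 0 :> k.
Proof.
rewrite kmw_eval_int; split=> [/eqP|->]; last by rewrite rmorph0.
by rewrite kconst_eq0 => /eqP.
Qed.

Lemma kmw_eval_ker_prime : prime_ideal [set x | kmw_eval x = 0].
Proof.
split.
- split=> [|x y /= x0 y0|a x /= x0] /=; first by rewrite rmorph0.
    by rewrite rmorphB /= x0 y0 subr0.
  by split; rewrite rmorphM /= x0 (mulr0, mul0r).
- move=> E; have : [set x | kmw_eval x = 0] 1 by rewrite E.
  by rewrite /= rmorph1 => /eqP; rewrite oner_eq0.
- by move=> a b /eqP; rewrite /= rmorphM mulf_eq0 => /orP[]/eqP; [left|right].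
Qed.

(** The degree-recording property of t: a relation between its distinct integer
    powers is trivial. *)
Lemma indet_free (s : seq int) (c : int -> k) : uniq s ->
  \sum_(n <- s) kconst (c n) * indet ^ n = 0 -> forall n, n \in s -> c n = 0.
Proof.
move=> us s0.
pose N := (\sum_(n <- s) absz n)%N.
have le0 n : n \in s -> 0 <= n + N%:Z.
  move=> ns; suff: (absz n <= N)%N by case: n {ns} => n //; rewrite NegzE => /=; lia.
  by rewrite /N (big_rem n) //= leq_addr.
(* Multiplying by t ^ N clears the negative powers and leaves a polynomial. *)
have : (\sum_(n <- s) c n *: 'X^(absz (n + N%:Z)%R) : {poly k}) = 0.
  apply/eqP; rewrite -tofrac_eq0 rmorph_sum /=; apply/eqP.
  transitivity (indet ^ N%:Z * \sum_(n <- s) kconst (c n) * indet ^ n).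
    rewrite mulr_sumr [LHS]big_seq [RHS]big_seq; apply: eq_bigr => n /le0 nN.
    rewrite -mul_polyC rmorphM rmorphXn /= mulrCA; congr (_ * _).
    rewrite -expfzDr ?indet_neq0 //.
    by rewrite [in RHS]addrC -[in RHS](gez0_abs (nN : 0 <= n + N%:Z)).
  by rewrite s0 mulr0.
move=> p0 n ns; have := congr1 (fun p : {poly k} => p`_(absz (n + N%:Z)%R)) p0.
rewrite coef0 coef_sum (bigD1_seq n) //= big_seq_cond big1 => [|m /andP[ms mn]].
  by rewrite coefZ coefXn eqxx mulr1 addr0.
rewrite coefZ coefXn; case: eqP => [E|_]; last by rewrite mulr0.
case/eqP: mn; apply: (addIr N%:Z).
by rewrite -(gez0_abs (le0 _ ms)) -(gez0_abs (le0 _ ns)) E.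
Qed.

End Points.

(** * Identities between symbols *)

Section KMWRelations.
Variable F : fieldType.
Local Notation sym := (@kmw_sym F).
Local Notation eta := (kmw_eta F).
Local Notation rho := (@kmw_sym F (fx_m1 F)).
Implicit Types a b : Fx F.

Lemma kmw_proj_rel r : kmw_rel r -> kmw_proj r = 0 :> KMW F.
Proof.
move=> rel; rewrite -(rmorph0 (@kmw_proj F)); apply/quot_projP.
by rewrite subr0; apply: sub_ideal_gen.
Qed.

Lemma kmw_symM a b : sym (fx_mul a b) = sym a + sym b + eta * sym a * sym b.
Proof.
apply/eqP; rewrite -subr_eq0 !opprD !addrA; apply/eqP.
rewrite -[RHS](kmw_proj_rel (r := free_gen (Some (fx_mul a b)) - free_gen (Some a)
  - free_gen (Some b) - free_gen None * free_gen (Some a) * free_gen (Some b))).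
  by rewrite !(rmorphB, rmorphM).
by left; left; left; exists a, b.
Qed.

Lemma kmw_steinberg a b : sval a + sval b = 1 -> sym a * sym b = 0.
Proof.
move=> ab; rewrite -rmorphM; apply: kmw_proj_rel.
by left; left; right; exists a, b.
Qed.

Lemma kmw_sym_eta a : sym a * eta = eta * sym a.
Proof.
apply/eqP; rewrite -subr_eq0; apply/eqP; rewrite -!rmorphM -rmorphB.
by apply: kmw_proj_rel; left; right; exists a.
Qed.

Lemma kmw_h_eta : kmw_h F * eta = 0.
Proof.
rewrite /kmw_h -kmw_sym_eta.
rewrite -(kmw_proj_rel (r :=
  (2%:R + free_gen (Some (fx_m1 F)) * free_gen None) * free_gen None)).
  by rewrite rmorphM rmorphD rmorphM rmorph_nat.
by right.
Qed.

Definition fx1 : Fx F := mkFx (oner_neq0 F).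
Definition fx_inv a : Fx F := mkFx (invr_neq0 (svalP a)).
Definition fx_opp a : Fx F := fx_mul (fx_m1 F) a.

Lemma fx_val_inj a b : sval a = sval b -> a = b.
Proof. by move=> E; apply: val_inj. Qed.

Lemma fx_mulC a b : fx_mul a b = fx_mul b a.
Proof. by apply: fx_val_inj; rewrite /= mulrC. Qed.

Lemma fx_mulV a : fx_mul a (fx_inv a) = fx1.
Proof. by apply: fx_val_inj; rewrite /= divff //; exact: svalP a. Qed.

Lemma fx_mulK a b : fx_mul (fx_mul b a) (fx_inv a) = b.
Proof. by apply: fx_val_inj; rewrite /= mulfK //; exact: svalP a. Qed.

Lemma fx_mulN1 : fx_mul (fx_m1 F) (fx_m1 F) = fx1.
Proof. by apply: fx_val_inj; rewrite /= mulrNN mulr1. Qed.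

Lemma fx_opp_opp a : fx_opp (fx_opp a) = a.
Proof. by apply: fx_val_inj; rewrite /= !mulN1r opprK. Qed.

(** By the product relation for (-1)(-1), the symbol of 1 is h [-1], which eta
    kills; by the product relation for 1 * 1 it is also a multiple of eta [1]. *)
Lemma kmw_sym1 : sym fx1 = 0.
Proof.
have e1 : eta * sym fx1 = 0.
  have -> : sym fx1 = kmw_h F * rho.
    by rewrite -fx_mulN1 kmw_symM /kmw_h mulrDl mulr_natl mulr2n.
  have -> : eta * (kmw_h F * rho) = kmw_h F * eta * rho; last by rewrite kmw_h_eta mul0r.
  rewrite mulrA /kmw_h.
  by rewrite mulrDl mulrDr mulr_natl mulr_natr -mulrA kmw_sym_eta.
have := kmw_symM fx1 fx1.
rewrite (_ : fx_mul fx1 fx1 = fx1) ?e1 ?mul0r ?addr0; last first.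
  by apply: fx_val_inj; rewrite /= mulr1.
by move/eqP; rewrite -[X in X == _]addr0 (inj_eq (addrI _)) => /eqP.
Qed.

Lemma kmw_h_rho : rho * kmw_h F = 0.
Proof.
rewrite -kmw_sym1 -fx_mulN1 kmw_symM /kmw_h mulrDr mulr_natr mulr2n.
by rewrite mulrA kmw_sym_eta.
Qed.

(** With b = 1 - 1/a one has 1 - a = (- a) b, so that the Steinberg relations for
    a and for 1/a show that [a][-a] is killed by the unit 1 + eta [b], whose inverse
    is 1 + eta [1/b].  For a = 1 there is no b, but then [a] = 0. *)
Lemma kmw_sym_opp a : sym a * sym (fx_opp a) = 0.
Proof.
have [a1|a1] := eqVneq (sval a) 1.
  by rewrite (_ : a = fx1) ?kmw_sym1 ?mul0r //; apply: fx_val_inj.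
have nz : 1 - (sval a)^-1 != 0 by rewrite subr_eq0 eq_sym invr_eq1.
pose b : Fx F := mkFx nz.
have ab : sym a * sym (fx_mul (fx_opp a) b) = 0.
  apply: kmw_steinberg; rewrite /= mulN1r mulrBr mulr1 mulNr divff ?opprK.
    by rewrite addNKr.
  exact: svalP a.
have Vab : sym (fx_inv a) * sym b = 0.
  by apply: kmw_steinberg; rewrite /= addrC subrK.
have b0 : sym a * sym b = 0.
  have := kmw_symM a (fx_inv a); rewrite fx_mulV kmw_sym1.
  move=> /(congr1 (fun x => x * sym b)).
  by rewrite mul0r !mulrDl -[_ * sym (fx_inv a) * _]mulrA Vab mulr0 !addr0.
have ub : (1 + eta * sym b) * (1 + eta * sym (fx_inv b)) = 1.
  rewrite mulrDl mul1r [X in _ + X]mulrDr mulr1.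
  rewrite (_ : eta * sym b * (eta * _) = eta * (eta * sym b * sym (fx_inv b))).
    rewrite -addrA -!mulrDr (addrC (sym (fx_inv b))) -addrA.
    rewrite (addrC _ (sym (fx_inv b))) addrA -kmw_symM.
    by rewrite fx_mulV kmw_sym1 mulr0 addr0.
  by rewrite !mulrA -[eta * _ * eta]mulrA kmw_sym_eta mulrA.
move: ab; rewrite kmw_symM !mulrDr b0 addr0 => E.
have aub : sym a * sym (fx_opp a) * (1 + eta * sym b) = 0.
  rewrite mulrDr mulr1 -[RHS]E !mulrA.
  by rewrite -[_ * sym (fx_opp a) * eta]mulrA kmw_sym_eta !mulrA.
by rewrite -[LHS]mulr1 -ub mulrA aub mul0r.
Qed.

End KMWRelations.

(** * Homogeneous elements modulo an ideal with cyclic graded quotient *)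

Section NormalForm.
Variable F : fieldType.
Local Notation sym := (@kmw_sym F).
Local Notation eta := (kmw_eta F).
Local Notation rho := (@kmw_sym F (fx_m1 F)).
Implicit Types I J : set (KMW F).

Definition degree_gen (n : int) : KMW F :=
  match n with Posz m => rho ^+ m | Negz m => eta ^+ m.+1 end.

(** Modulo such an ideal each graded piece is generated by a single element, the
    one given by degree_gen. *)
Definition graded_cyclic I : Prop :=
  [/\ two_sided_ideal I, forall a, I (sym a) \/ I (sym a - rho) &
      exists c : int, I (eta * rho - c%:~R)].

Lemma degree_gen_rho (n : int) : 0 <= n -> rho * degree_gen n = degree_gen (1 + n).
Proof. by case: n => // n _; rewrite /= -exprS. Qed.

Lemma degree_gen_eta (n : int) : n <= 0 -> eta * degree_gen n = degree_gen (-1 + n).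
Proof.
by case: n => [[|n]|n] // _; rewrite /= mulr1 expr1.
Qed.

Section Reduce.
Variable I : set (KMW F).
Hypothesis rI : graded_cyclic I.

Let idI : two_sided_ideal I. Proof. by case: rI. Qed.

Lemma eta_rho_cancel (c : int) (x : KMW F) : I (eta * rho - c%:~R) ->
  I (eta * (rho * x) - x *~ c) /\ I (rho * (eta * x) - x *~ c).
Proof.
move=> Ic; have E : I (eta * (rho * x) - x *~ c).
  by rewrite mulrA -mulrzl -mulrBl; apply: ideal_mulR.
by split=> //; rewrite mulrA kmw_sym_eta -mulrA.
Qed.

(** Left multiplication by a generator moves from one power to the next; crossing
    degree 0 replaces eta rho by an integer. *)
Lemma degree_gen_step g (n : int) : exists c : int,
  I (kmw_proj (free_gen g) * degree_gen n - degree_gen (gen_deg g + n) *~ c).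
Proof.
have [_ symI [c0 Ic0]] := rI.
case: g => [a|]; [rewrite -[kmw_proj _]/(sym a) /=|rewrite -[kmw_proj _]/eta /=].
  have rho_step : exists c : int, I (rho * degree_gen n - degree_gen (1 + n) *~ c).
    have [n0|n0] := leP 0 n.
      by exists 1; rewrite mulr1z degree_gen_rho // subrr; apply: ideal_zero.
    exists c0; have [_] := eta_rho_cancel (degree_gen (1 + n)) Ic0.
    by rewrite degree_gen_eta ?addKr //; lia.
  have [Ia|Ia] := symI a.
    by exists 0; rewrite mulr0z subr0; apply: ideal_mulR.
  have [c Ic] := rho_step; exists c.
  by apply: ideal_cong_trans Ic => //; rewrite -mulrBl; apply: ideal_mulR.
have [n0|n0] := leP n 0.
  by exists 1; rewrite mulr1z degree_gen_eta // subrr; apply: ideal_zero.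
exists c0; have [+ _] := eta_rho_cancel (degree_gen (-1 + n)) Ic0.
by rewrite degree_gen_rho ?addNKr //; lia.
Qed.

Lemma word_reduce (w : {fmonom (kmw_gen F)}) : exists c : int,
  I (kmw_proj (mkmalgU w 1) - degree_gen (word_deg w) *~ c).
Proof.
case: w => w; elim: w => [|g w [c Ic]].
  exists 1; rewrite /word_deg big_nil /= expr0 mulr1z.
  have -> : mkmalgU (FMonom [::]) 1 = 1 :> kmw_free F.
    by rewrite -fmoneE.
  by rewrite rmorph1 subrr; apply: ideal_zero.
have -> : mkmalgU (FMonom (g :: w)) 1 = free_gen g * mkmalgU (FMonom w) 1 :> kmw_free F.
  rewrite /free_gen malgM_def fgmulUU mulr1; congr mkmalgU.
  by apply: val_inj; rewrite /= fmM fmU.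
rewrite rmorphM; have [d Id] := degree_gen_step g (word_deg (FMonom w)).
exists (d * c).
have -> : word_deg (FMonom (g :: w)) = gen_deg g + word_deg (FMonom w).
  by rewrite /word_deg big_cons.
apply: (ideal_cong_trans idI
  (y := kmw_proj (free_gen g) * (degree_gen (word_deg (FMonom w)) *~ c))).
  by rewrite -mulrBr; apply: ideal_mulL.
by rewrite mulrzAr mulrzA -mulrzBl; apply: ideal_mulz.
Qed.

Lemma kmw_proj_sum (y : kmw_free F) :
  kmw_proj y = \sum_(w <- msupp y) kmw_proj (mkmalgU w 1) *~ y@_w.
Proof.
rewrite {1}[y]monalgE rmorph_sum; apply: eq_bigr => w _.
rewrite -[in LHS](intz (y@_w)) -[_%:~R]mulr1 mulrzl.
by rewrite -!raddfMz.
Qed.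

Lemma homog_reduce n (x : KMW F) : kmw_graded n x ->
  exists c : int, I (x - degree_gen n *~ c).
Proof.
move=> [y yn <-]; have [c Ic] := choice word_reduce.
exists (\sum_(w <- msupp y) c w * y@_w).
rewrite kmw_proj_sum mulrz_sumr -sumrB big_seq.
apply: ideal_sum => // w; rewrite -mcoeff_neq0 => /eqP /yn <-.
by rewrite mulrzA -mulrzBl; apply: ideal_mulz.
Qed.

(** Grouping the words of x by degree gives the degrees in the list s without
    repetition, as the independence of powers of t requires. *)
Lemma normal_form (x : KMW F) : exists2 s : seq int, uniq s &
  exists c : int -> int, I (x - \sum_(n <- s) degree_gen n *~ c n).
Proof.
have [c Ic] := choice word_reduce; have [y ->] := kmw_projK x.
pose s := undup [seq word_deg w | w <- msupp y].
exists s; first exact: undup_uniq.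
exists (fun n => \sum_(w <- msupp y | word_deg w == n) c w * y@_w).
rewrite kmw_proj_sum.
rewrite (eq_bigr (fun n =>
  \sum_(w <- msupp y | word_deg w == n) degree_gen n *~ (c w * y@_w))); last first.
  by move=> n _; rewrite mulrz_sumr.
rewrite (exchange_big_dep predT) //= -sumrB big_seq; apply: ideal_sum => // w wy.
rewrite (_ : \sum_(n <- s | _) _ = degree_gen (word_deg w) *~ (c w * y@_w)).
  by rewrite mulrzA -mulrzBl; apply: ideal_mulz.
rewrite -big_filter (eq_filter (a2 := pred1 (word_deg w))); last first.
  by move=> n; rewrite /= eq_sym.
rewrite filter_pred1_uniq ?undup_uniq ?big_seq1 //.
by rewrite mem_undup map_f.
Qed.

End Reduce.

Section Kernel.
Variables (k : fieldType) (P : kmw_point F k).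

(** The exceptional cases are those in which the generator of degree n has to be
    in the kernel. *)
Lemma kmw_eval_degree_gen n : exists2 d : k,
    kmw_eval P (degree_gen n) = kconst d * indet k ^ n &
    d = 0 -> (0 < n /\ pt_sym P (fx_m1 F) = 0) \/ (n < 0 /\ pt_eta P = 0).
Proof.
case: n => n /=.
  exists (pt_sym P (fx_m1 F) ^+ n).
    by rewrite rmorphXn /= kmw_eval_sym exprMn -rmorphXn.
  by case: n => [/eqP|n /eqP]; rewrite ?expr0 ?oner_eq0 // expf_eq0 /= => /eqP; left.
exists (pt_eta P ^+ n.+1).
  by rewrite rmorphXn /= kmw_eval_eta exprMn -rmorphXn exprVn.
by move/eqP; rewrite expf_eq0 /= => /eqP; right.
Qed.

(** In the normal form of an element of the kernel each coefficient vanishes in k,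
    or its power of rho or eta is killed by the morphism; the last three hypotheses
    say that such terms lie in I. *)
Theorem ideal_eq_kernel I : graded_cyclic I ->
    (forall x, I x -> kmw_eval P x = 0) ->
    (forall c : int, c%:~R = 0 :> k -> I c%:~R) ->
    (pt_sym P (fx_m1 F) = 0 -> I rho) -> (pt_eta P = 0 -> I eta) ->
  forall x, I x <-> kmw_eval P x = 0.
Proof.
move=> rI IK intI rhoI etaI x; split=> [/IK//|x0].
have idI : two_sided_ideal I by case: rI.
have [s us [c Ixc]] := normal_form rI x.
apply/(ideal_cong idI Ixc).
have [d dE] := choice (fun n => let: ex_intro2 d E1 E2 := kmw_eval_degree_gen n in
  ex_intro _ d (conj E1 E2)).
have cd0 n : n \in s -> (c n)%:~R * d n = 0.
  move: n; apply: (@indet_free k s (fun n => (c n)%:~R * d n) us).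
  transitivity (kmw_eval P (x - (x - \sum_(n <- s) degree_gen n *~ c n))).
    rewrite subKr rmorph_sum; apply: eq_bigr => m _.
    by rewrite rmorphMz /= (dE m).1 rmorphM rmorph_int -mulrA mulrzl.
  by rewrite rmorphB /= x0 IK // subr0.
rewrite big_seq; apply: ideal_sum => // n /cd0/eqP; rewrite mulf_eq0 => /orP[]/eqP.
  by move/intI => Ic; rewrite -mulrzr; apply: ideal_mulL.
move/(dE n).2 => [[n0 /rhoI]|[n0 /etaI]] Igen; apply: ideal_mulz => //;
  by case: n n0 => [[|n]|n] // _; rewrite /= exprS; apply: ideal_mulR.
Qed.

Lemma kernel_prime I : (forall x, I x <-> kmw_eval P x = 0) -> prime_ideal I.
Proof.
move=> IP; rewrite (_ : I = [set x | kmw_eval P x = 0]).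
  exact: kmw_eval_ker_prime.
by apply/seteqP; split=> x /IP.
Qed.

End Kernel.

(** Modulo I, a homogeneous generator of J is an integer times a power of rho or of
    eta, and since J is prime, it contains the integer or rho or eta. *)
Lemma homog_prime_eq I J : graded_cyclic I -> I `<=` J ->
    prime_ideal J -> homog_ideal J ->
    (forall c : int, J c%:~R -> I c%:~R) -> (J rho -> I rho) -> (J eta -> I eta) ->
  J = I.
Proof.
move=> rI IJ prJ [S homS JS] intJ rhoJ etaJ.
have idI : two_sided_ideal I by case: rI.
have idJ := prime_ideal_ideal prJ.
apply/seteqP; split=> //; rewrite {1}JS; apply: ideal_gen_min => // x Sx.
have [n xn] := homS x Sx; have [c Ixc] := homog_reduce rI xn.
have Jx : J x by rewrite JS; apply: sub_ideal_gen.
apply/(ideal_cong idI Ixc).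
have := (ideal_cong idJ (IJ _ Ixc)).1 Jx.
rewrite -mulrzr => /(prime_idealM prJ)[|]; last first.
  by move/intJ; exact: ideal_mulL.
case: n {xn Ixc} => [[/(prime_ideal1 prJ)//|n]|n] /(prime_idealX prJ) => [/rhoJ|/etaJ] Ig;
  by apply: ideal_mulR => //; rewrite /= exprS; apply: ideal_mulR.
Qed.

End NormalForm.

(** * Homogeneity, and the listed ideals as kernels *)

Section Homogeneous.
Variable F : fieldType.
Local Notation sym := (@kmw_sym F).
Local Notation eta := (kmw_eta F).

Lemma free_homog_gen g : free_homog (gen_deg g) (free_gen g : kmw_free F).
Proof.
move=> w; rewrite /free_gen mcoeffU1; case: eqP => // <- _.
by rewrite /word_deg fmU big_seq1.
Qed.

Lemma free_homogM m n (x y : kmw_free F) :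
  free_homog m x -> free_homog n y -> free_homog (m + n) (x * y).
Proof.
move=> xm yn w /eqP; rewrite mcoeff_neq0 => /msuppM_le[u [v [ux vy ->]]].
rewrite /word_deg fmM big_cat /=; congr (_ + _).
  by apply: xm; apply/eqP; rewrite mcoeff_neq0.
by apply: yn; apply/eqP; rewrite mcoeff_neq0.
Qed.

Lemma free_homogD n (x y : kmw_free F) :
  free_homog n x -> free_homog n y -> free_homog n (x + y).
Proof.
move=> xn yn w; rewrite mcoeffD => xy0.
have [x0|/eqP/xn//] := eqVneq (mcoeff w x) 0.
by apply: yn => y0; apply: xy0; rewrite x0 y0.
Qed.

Lemma free_homog_nat n : free_homog 0 (n%:R : kmw_free F).
Proof.
elim: n => [|n IH]; first by move=> w; rewrite mcoeff0.
rewrite mulrSr; apply: free_homogD => // w; rewrite mcoeff1; case: eqP => // -> _.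
by rewrite /word_deg fm1 big_nil.
Qed.

Lemma homogeneous_sym a : homogeneous (sym a).
Proof. by exists 1, (free_gen (Some a)) => //; exact: free_homog_gen. Qed.

Lemma homogeneous_eta : homogeneous eta.
Proof. by exists (-1), (free_gen None) => //; exact: free_homog_gen. Qed.

Lemma homogeneous_nat n : homogeneous (n%:R : KMW F).
Proof. by exists 0, n%:R; [exact: free_homog_nat|rewrite rmorph_nat]. Qed.

Lemma homogeneous_h : homogeneous (kmw_h F).
Proof.
exists 0, (2%:R + free_gen None * free_gen (Some (fx_m1 F))).
  apply: free_homogD; first exact: free_homog_nat.
  rewrite -[0](addNr 1); apply: free_homogM; exact: free_homog_gen.
by rewrite rmorphD rmorphM rmorph_nat.
Qed.

Lemma symbols_homogeneous (S : set (Fx F)) : symbols S `<=` @homogeneous F.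
Proof. by move=> _ [a _ <-]; exact: homogeneous_sym. Qed.

Lemma kernel_spech k (P : kmw_point F k) (S : set (KMW F)) :
  S `<=` @homogeneous F ->
  (forall x, ideal_gen S x <-> kmw_eval P x = 0) -> spech F (ideal_gen S).
Proof. by move=> homS /kernel_prime; split=> //; exists S. Qed.

End Homogeneous.

Section OrderingPoints.
Variables (F : fieldType) (alpha : Fx F -> bool).
Hypothesis ord : is_ordering alpha.

Lemma orderingM a b : alpha (fx_mul a b) = alpha a (+) alpha b.
Proof. by case: ord => _ + _; apply. Qed.

Lemma ordering1 : alpha (fx1 F) = false.
Proof. by rewrite -(fx_mulN1 F) orderingM addbb. Qed.

Lemma ordering_m1 : alpha (fx_m1 F) = true.
Proof.
apply/negPn/negP => /negbTE n1; case: ord => _ _ /(_ _ _ ordering1 n1)[].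
by move=> nz _; case/negP: nz; rewrite /= subrr.
Qed.

Lemma ordering_opp a : alpha (fx_opp a) = ~~ alpha a.
Proof. by rewrite orderingM ordering_m1. Qed.

(** If a and b were both negative, -1 = (- a) + (- b) would be positive. *)
Lemma ordering_steinberg a b : sval a + sval b = 1 -> alpha a && alpha b = false.
Proof.
move=> ab; apply/negP => /andP[pa pb]; case: ord => _ _.
move=> /(_ (fx_opp a) (fx_opp b)); rewrite !ordering_opp pa pb => /(_ erefl erefl)[nz].
rewrite (_ : mkFx nz = fx_m1 F) ?ordering_m1 //.
by apply: fx_val_inj; rewrite /= !mulN1r -opprD ab.
Qed.

Section PointOverField.
Variable k : fieldType.

Lemma ord_pt_symM a b : (alpha (fx_mul a b))%:R =
  (alpha a)%:R + (alpha b)%:R + (- 2%:R) * (alpha a)%:R * (alpha b)%:R :> k.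
Proof. by rewrite orderingM; case: (alpha a) (alpha b) => [] []; rewrite /=; ring. Qed.

Lemma ord_pt_steinberg a b : sval a + sval b = 1 -> (alpha a)%:R * (alpha b)%:R = 0 :> k.
Proof. by move=> /ordering_steinberg; rewrite -natrM mulnb => ->. Qed.

Lemma ord_pt_hyperbolic : (2%:R + (alpha (fx_m1 F))%:R * - 2%:R) * - 2%:R = 0 :> k.
Proof. by rewrite ordering_m1 mul1r subrr mul0r. Qed.

(** The morphism attached to an ordering: 0 on positive units, 1 on negative ones,
    and the value - 2 for eta, which is forced by 2 + eta rho = 0. *)
Definition ordering_point : kmw_point F k :=
  KmwPoint ord_pt_symM ord_pt_steinberg ord_pt_hyperbolic.

End PointOverField.

(** A negative a is -1 times a positive unit, whence [a] is congruent to rho. *)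
Lemma graded_cyclic_ordered (I : set (KMW F)) : two_sided_ideal I ->
  symbols (pos_cone alpha) `<=` I -> I (kmw_h F) -> graded_cyclic I.
Proof.
move=> idI PI Ih; split=> // [a|]; last first.
  by exists (- 2%:R); rewrite rmorphN /= rmorph_nat opprK addrC.
case pa: (alpha a); last by left; apply: PI; exists a.
right; rewrite -[in kmw_sym a](fx_opp_opp a) [fx_opp (fx_opp a)]/fx_opp.
rewrite kmw_symM addrC -addrA addKr.
have Ina : I (kmw_sym (fx_opp a)).
  by apply: PI; exists (fx_opp a) => //; rewrite /pos_cone /= ordering_opp pa.
by apply: ideal_add => //; apply: ideal_mulL.
Qed.

Lemma ordering_kernel k (X : set (KMW F)) :
    let I := ideal_gen (symbols (pos_cone alpha) `|` X) in
    (forall x, X x -> kmw_eval (ordering_point k) x = 0) -> I (kmw_h F) ->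
    (forall c : int, c%:~R = 0 :> k -> I c%:~R) ->
    (2%:R = 0 :> k -> I (kmw_eta F)) ->
  forall x, I x <-> kmw_eval (ordering_point k) x = 0.
Proof.
move=> I X0 Ih intI etaI; have idI : two_sided_ideal I by exact: ideal_gen_ideal.
have [kerI _ _] := kmw_eval_ker_prime (ordering_point k).
apply: ideal_eq_kernel => //.
- by apply: graded_cyclic_ordered => // x Px; apply: sub_ideal_gen; left.
- apply: ideal_gen_min => // x [[a pa <-]|/X0//].
  by apply/kmw_eval_sym_eq0; rewrite /= (pa : alpha a = false).
- by move=> /eqP; rewrite /= ordering_m1 oner_eq0.
- by move=> /eqP; rewrite /= oppr_eq0 => /eqP/etaI.
Qed.

End OrderingPoints.

Section TrivialPoints.
Variables (F k : fieldType) (e : k).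
Hypothesis e2 : 2%:R * e = 0.

Definition zero_sym (a : Fx F) : k := 0.

Lemma zero_symM a b :
  zero_sym (fx_mul a b) = zero_sym a + zero_sym b + e * zero_sym a * zero_sym b.
Proof. by rewrite /zero_sym !mulr0 !addr0. Qed.

Lemma zero_steinberg a b : sval a + sval b = 1 -> zero_sym a * zero_sym b = 0.
Proof. by rewrite /zero_sym mulr0. Qed.

Lemma zero_hyperbolic : (2%:R + zero_sym (fx_m1 F) * e) * e = 0.
Proof. by rewrite mul0r addr0 e2. Qed.

(** The morphisms killing every symbol; the condition 2 e = 0 is what remains of
    the relation eta h = 0. *)
Definition trivial_point : kmw_point F k :=
  KmwPoint zero_symM zero_steinberg zero_hyperbolic.

Lemma graded_cyclic_full (I : set (KMW F)) : two_sided_ideal I ->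
  symbols setT `<=` I -> graded_cyclic I.
Proof.
move=> idI SI; have symI a : I (kmw_sym a) by apply: SI; exists a.
split=> //; first by left.
by exists 0; rewrite subr0; apply: ideal_mulL.
Qed.

Lemma trivial_kernel (X : set (KMW F)) :
    let I := ideal_gen (symbols setT `|` X) in
    (forall x, X x -> kmw_eval trivial_point x = 0) ->
    (forall c : int, c%:~R = 0 :> k -> I c%:~R) ->
    (e = 0 -> I (kmw_eta F)) ->
  forall x, I x <-> kmw_eval trivial_point x = 0.
Proof.
move=> I X0 intI etaI; have idI : two_sided_ideal I by exact: ideal_gen_ideal.
have [kerI _ _] := kmw_eval_ker_prime trivial_point.
have symI a : I (kmw_sym a) by apply: sub_ideal_gen; left; exists a.
apply: ideal_eq_kernel => //.
- by apply: graded_cyclic_full => // x Px; apply: sub_ideal_gen; left.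
- by apply: ideal_gen_min => // x [[a _ <-]|/X0//]; apply/kmw_eval_sym_eq0.
Qed.

End TrivialPoints.

Section Characteristic.
Variables (F : fieldType) (I : set (KMW F)).
Hypothesis idI : two_sided_ideal I.

Lemma ideal_rat_int (c : int) : c%:~R = 0 :> rat -> I c%:~R.
Proof. by move/eqP; rewrite intr_eq0 => /eqP ->; apply: ideal_zero. Qed.

Lemma ideal_dvdz p (c : int) : I p%:R -> (p %| c)%Z -> I c%:~R.
Proof. by move=> Ip /dvdzP[d ->]; rewrite rmorphM; apply: ideal_mulL. Qed.

Lemma Fp_int_eq0 p (c : int) : prime p -> c%:~R = 0 :> 'F_p <-> (p %| c)%Z.
Proof.
move=> p_pr; rewrite (dvdz_pcharf (pchar_Fp p_pr)).
by split=> /eqP.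
Qed.

Lemma ideal_Fp_int p (c : int) : prime p -> I p%:R -> c%:~R = 0 :> 'F_p -> I c%:~R.
Proof. by move=> p_pr Ip /(Fp_int_eq0 _ p_pr); exact: ideal_dvdz. Qed.

Lemma Fp2_eq0 p : prime p -> odd p -> 2%:R != 0 :> 'F_p.
Proof.
move=> p_pr p_odd; apply/eqP => /(Fp_int_eq0 2 p_pr).
by rewrite dvdzE /= dvdn_prime2 // => /eqP E; rewrite E in p_odd.
Qed.

End Characteristic.

Section Families.
Variable F : fieldType.
Local Notation eta := (kmw_eta F).
Local Notation h := (kmw_h F).

Lemma kmw_eval_nat_eq0 k (P : kmw_point F k) n : kmw_eval P n%:R = 0 <-> n%:R = 0 :> k.
Proof. exact: (kmw_eval_int_eq0 P n). Qed.

Lemma ordering_eval_h k alpha (ord : is_ordering alpha) :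
  kmw_eval (ordering_point ord k) h = 0.
Proof.
rewrite rmorphD rmorph_nat rmorphM /= kmw_eval_eta kmw_eval_sym /=.
rewrite mulrACA mulVf ?indet_neq0 // mulr1 -rmorphM -(rmorph_nat (@kconst k)) -rmorphD.
by rewrite (ordering_m1 ord) mulr1 subrr rmorph0.
Qed.

Definition ideal_A alpha := ideal_gen (symbols (pos_cone alpha) `|` [set h]).
Definition ideal_B alpha := ideal_gen (symbols (pos_cone alpha) `|` [set 2%:R; eta]).
Definition ideal_C alpha p := ideal_gen (symbols (pos_cone alpha) `|` [set h; p%:R]).
Definition ideal_D p := ideal_gen (symbols [set: Fx F] `|` [set eta; p%:R]).

Lemma ideal_A_kernel alpha (ord : is_ordering alpha) x :
  ideal_A alpha x <-> kmw_eval (ordering_point ord rat) x = 0.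
Proof.
apply: ordering_kernel => {x} [x ->|| |]; first exact: ordering_eval_h.
- by apply: sub_ideal_gen; right.
- by move=> c; apply: ideal_rat_int; exact: ideal_gen_ideal.
- by move/eqP; rewrite pnatr_eq0.
Qed.

Lemma ideal_B_h alpha : ideal_B alpha h.
Proof.
have idI := ideal_gen_ideal (symbols (pos_cone alpha) `|` [set 2%:R; eta]).
rewrite /kmw_h; apply: (ideal_add idI); first by apply: sub_ideal_gen; right; left.
by apply: (ideal_mulR idI); apply: sub_ideal_gen; right; right.
Qed.

Lemma ideal_B_kernel alpha (ord : is_ordering alpha) x :
  ideal_B alpha x <-> kmw_eval (ordering_point ord 'F_2) x = 0.
Proof.
have two0 : 2%:R = 0 :> 'F_2 by exact/eqP.
apply: ordering_kernel => {x} [x [->|->]|| |].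
- exact/kmw_eval_nat_eq0.
- by apply/kmw_eval_eta_eq0; rewrite /= two0 oppr0.
- exact: ideal_B_h.
- move=> c; apply: ideal_Fp_int => //; first exact: ideal_gen_ideal.
  by apply: sub_ideal_gen; right; left.
- by move=> _; apply: sub_ideal_gen; right; right.
Qed.

Lemma ideal_C_kernel alpha (ord : is_ordering alpha) p x : prime p -> odd p ->
  ideal_C alpha p x <-> kmw_eval (ordering_point ord 'F_p) x = 0.
Proof.
move=> p_pr p_odd.
apply: ordering_kernel => {x} [x [->|->]|| |].
- exact: ordering_eval_h.
- by apply/kmw_eval_nat_eq0/(Fp_int_eq0 p p_pr); rewrite dvdzz.
- by apply: sub_ideal_gen; right; left.
- move=> c; apply: ideal_Fp_int => //; first exact: ideal_gen_ideal.
  by apply: sub_ideal_gen; right; right.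
- by move=> /eqP; rewrite (negPf (Fp2_eq0 p_pr p_odd)).
Qed.

Lemma ideal_D_kernel p x : prime p ->
  ideal_D p x <-> kmw_eval (trivial_point F (mulr0 (2%:R : 'F_p))) x = 0.
Proof.
move=> p_pr; apply: trivial_kernel => {x} [x [->|->]||].
- exact/kmw_eval_eta_eq0.
- by apply/kmw_eval_nat_eq0/(Fp_int_eq0 p p_pr); rewrite dvdzz.
- move=> c; apply: ideal_Fp_int => //; first exact: ideal_gen_ideal.
  by apply: sub_ideal_gen; right; right.
- by move=> _; apply: sub_ideal_gen; right; left.
Qed.

Lemma ideal_eta_kernel x :
  ideal_eta F x <-> kmw_eval (trivial_point F (mulr0 (2%:R : rat))) x = 0.
Proof.
apply: trivial_kernel => {x} [x ->||]; first exact/kmw_eval_eta_eq0.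
- by move=> c; apply: ideal_rat_int; exact: ideal_gen_ideal.
- by move=> _; apply: sub_ideal_gen; right.
Qed.

Lemma ideal_2_eta_kernel x :
  ideal_2_eta F x <-> kmw_eval (trivial_point F (mulr0 (2%:R : 'F_2))) x = 0.
Proof.
apply: trivial_kernel => {x} [x [->|->]||].
- exact/kmw_eval_nat_eq0/eqP.
- exact/kmw_eval_eta_eq0.
- move=> c; apply: ideal_Fp_int => //; first exact: ideal_gen_ideal.
  by apply: sub_ideal_gen; right; left.
- by move=> _; apply: sub_ideal_gen; right; right.
Qed.

(** Over the field with two elements eta may take the value 1, so that the ideal
    generated by the symbols and 2 is a prime without eta. *)
Fact two_mul1_F2 : 2%:R * 1 = 0 :> 'F_2. Proof. exact/eqP. Qed.

Lemma ideal_2_kernel x :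
  ideal_2 F x <-> kmw_eval (trivial_point F two_mul1_F2) x = 0.
Proof.
apply: trivial_kernel => {x} [x ->||].
- exact/kmw_eval_nat_eq0/eqP.
- move=> c; apply: ideal_Fp_int => //; first exact: ideal_gen_ideal.
  by apply: sub_ideal_gen; right.
- by move/eqP; rewrite oner_eq0.
Qed.

End Families.

(** * Neighbourhoods in the spectrum and in the space of orderings *)

Section Topology.
Variable F : fieldType.

Lemma nbhs_Spech_D (J : Spech F) q : ~ set_val J q ->
  nbhs J [set J' : Spech F | ~ set_val J' q].
Proof.
set D := [set J' : Spech F | ~ set_val J' q] => Jq.
exists D; split=> //; exists [set D]; last first.
  by rewrite predeqE => ?; split=> [[_ ->]|] //; exists D.
move=> _ ->; exists [fset q]%fset; first by move=> ? _; rewrite in_setT.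
apply/seteqP; split=> [J' H|J' J'q r].
  exact: (H q (fset11 q)).
by move=> /fset1P ->.
Qed.

(** Continuity may be tested on the subbasis of the sets D(q). *)
Lemma continuous_to_Spech (X : topologicalType) (f : X -> Spech F) :
  (forall q x, ~ set_val (f x) q -> nbhs x [set y | ~ set_val (f y) q]) ->
  continuous f.
Proof.
move=> fD x A [_ [[B sB <-] [C BC Cfx] sUBA]].
rewrite nbhs_filterE /=; apply: (@filterS _ _ _ (f @^-1` C)) => [y Cfy|].
  by apply: sUBA; exists C.
have [D _ IDeC] := sB _ BC; move: Cfx; rewrite -IDeC => Dfx.
rewrite preimage_bigcap.
by apply: filter_bigI => q qD; apply: fD; exact: (Dfx q qD).
Qed.

Definition ordering_of (alpha : X_ F) : Fx F -> bool :=
  @set_val _ (@orderings F) alpha.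

Lemma near_ordering (alpha : X_ F) (l : seq (Fx F)) :
  nbhs alpha [set beta : X_ F | {in l, ordering_of beta =1 ordering_of alpha}].
Proof.
elim: l => [|a l IH]; first by apply: filterS filterT => beta _ b; rewrite in_nil.
have near_a : nbhs alpha [set beta : X_ F | ordering_of beta a = ordering_of alpha a].
  have /(_ alpha) c1 :=
    @initial_continuous (X_ F) {ptws Fx F -> bool} (@set_val _ (@orderings F)).
  have c2 := @proj_continuous (Fx F) (fun=> bool) a (ordering_of alpha).
  have /(_ [set ordering_of alpha a]) := cvg_comp _ _ c1 c2.
  by apply; exact: discrete_set1.
apply: filterS (filterI near_a IH) => beta [/= Ea El] b.
by rewrite inE => /orP[/eqP ->|/El].
Qed.

Lemma continuous_to_X (Y : topologicalType) (f : Y -> X_ F) :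
  (forall a y, nbhs y [set z | ordering_of (f z) a = ordering_of (f y) a]) ->
  continuous f.
Proof.
move=> fa; apply: (@continuous_comp_initial _ _ _ (@set_val _ (@orderings F))) => y.
apply/cvg_sup => a U [_ [[V oV <-] Vfy] VU].
rewrite nbhs_filterE /=; apply: filterS (fa a y) => z zE; apply: VU.
by change (V (ordering_of (f z) a)); rewrite zE; exact: Vfy.
Qed.

End Topology.

(** * Families of ideals indexed by the orderings *)

Section OrderingFamilies.
Variables (F k : fieldType).
Local Notation sym := (@kmw_sym F).

(** An element of the ring is written with finitely many symbols. *)
Lemma ordering_eval_local (x : KMW F) : exists l : seq (Fx F),
  forall alpha beta (oa : is_ordering alpha) (ob : is_ordering beta),
    {in l, alpha =1 beta} ->
    kmw_eval (ordering_point oa k) x = kmw_eval (ordering_point ob k) x.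
Proof.
have [y ->] := kmw_projK x.
exists (flatten [seq pmap id (fmonom_val w) | w <- msupp y]).
move=> alpha beta oa ob ab; rewrite !kmw_eval_proj.
apply: eq_big_seq => w wy; congr (_ * _); apply: eq_big_seq => -[a|//] aw /=.
rewrite ab //; apply/flattenP; exists (pmap id (fmonom_val w)); first exact: map_f.
by rewrite mem_pmap map_id.
Qed.

Variable I : (Fx F -> bool) -> set (KMW F).
Hypothesis kerI : forall alpha (ord : is_ordering alpha) x,
  I alpha x <-> kmw_eval (ordering_point ord k) x = 0.
Hypothesis Ispech : forall alpha, is_ordering alpha -> spech F (I alpha).

Lemma ordering_familyP alpha a : is_ordering alpha ->
  I alpha (sym a) <-> alpha a = false.
Proof.
move=> ord; rewrite (kerI ord) kmw_eval_sym_eq0 /=.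
by case: (alpha a); split=> // /eqP; rewrite oner_eq0.
Qed.

Lemma ordering_family_inj alpha beta : is_ordering alpha -> is_ordering beta ->
  I alpha = I beta -> alpha = beta.
Proof.
move=> oa ob E; apply/funext => a.
have A := ordering_familyP a oa; have B := ordering_familyP a ob.
rewrite E in A; case: (alpha a) (beta a) A B => [] [] // A B.
  exact/A/B.
by apply/esym/B/A.
Qed.

(** Stated for any family of ideals that are the kernels at orderings over one
    field k: the rational numbers give the generators with h, and the field with two
    elements gives those with 2 and eta. *)
Lemma ordering_family_homeomorphic (Y : set (set (KMW F))) :
  (forall J, Y J <-> exists2 alpha, is_ordering alpha & J = I alpha) ->
  homeomorphic (subspech Y) (X_ F) /\ homeomorphic (X_ F) (subspech Y).
Proof.
move=> YE.
have ordX (alpha : X_ F) : is_ordering (ordering_of alpha) by exact: set_valP.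
have /choice[f fP] (y : subspech Y) : exists alpha : X_ F,
    set_val (set_val y) = I (ordering_of alpha).
  have : Y (set_val (set_val y)) by exact: (set_valP y).
  by move=> /YE[alpha oa E]; exists (SigSub (mem_set oa)).
have /choice[g gP] (alpha : X_ F) : exists y : subspech Y,
    set_val (set_val y) = I (ordering_of alpha).
  pose J : Spech F := SigSub (mem_set (Ispech (ordX alpha))).
  have YJ : Y (set_val J) by apply/YE; exists (ordering_of alpha).
  by exists (SigSub (mem_set (YJ : [set J : Spech F | Y (set_val J)] J))).
have fK : cancel f g.
  by move=> y; apply: val_inj; apply: val_inj; rewrite [LHS]gP -fP.
have gK : cancel g f.
  move=> alpha; apply: val_inj.
  apply: (ordering_family_inj (ordX (f (g alpha))) (ordX alpha)).
  by rewrite -fP gP.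
have fC : continuous f.
  apply: continuous_to_X => a y.
  (* Each of the two values of the sign of a is the non-membership of a symbol, [a]
      for the value -1 and [-a] for the value 1. *)
  have sep (b : bool) (z : subspech Y) : ordering_of (f z) a = b <->
      ~ set_val (set_val z) (sym (if b then a else fx_opp a)).
    rewrite fP; have := ordX (f z); move: (ordering_of (f z)) => alpha oa.
    rewrite ordering_familyP //.
    by case: b => /=; rewrite ?(ordering_opp oa); case: (alpha a).
  have /(_ y) c := @initial_continuous (subspech Y) (Spech F) set_val.
  pose q := sym (if ordering_of (f y) a then a else fx_opp a).
  have Dy : nbhs y [set z : subspech Y | ~ set_val (set_val z) q].
    exact: (c _ (nbhs_Spech_D ((sep _ y).1 erefl))).
  by apply: filterS Dy => z /= Dz; apply/sep.
have gC : continuous g.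
  apply: (@continuous_comp_initial _ _ _ (set_val : subspech Y -> Spech F)).
  apply: continuous_to_Spech => q alpha; rewrite [set_val _]gP => Iq.
  have [l lP] := ordering_eval_local q.
  apply: filterS (near_ordering alpha l) => beta ab.
  change (~ set_val (set_val (g beta)) q).
  rewrite gP (kerI (ordX beta)) (lP _ _ _ (ordX alpha)) //.
  by rewrite -(kerI (ordX alpha)).
by split; [exists f, g|exists g, f].
Qed.

End OrderingFamilies.

Lemma homeomorphic_trans (X Y Z : topologicalType) :
  homeomorphic X Y -> homeomorphic Y Z -> homeomorphic X Z.
Proof.
move=> [f [f' [fK f'K fC f'C]]] [g [g' [gK g'K gC g'C]]].
exists (g \o f), (f' \o g'); split; [exact: can_comp|exact: can_comp| |].
  by move=> x; apply: continuous_comp; [exact: fC|exact: gC].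
by move=> x; apply: continuous_comp; [exact: g'C|exact: f'C].
Qed.

(** * Classification of the homogeneous primes *)

Section Classification.
Variables (F : fieldType).
Local Notation sym := (@kmw_sym F).
Local Notation eta := (kmw_eta F).
Local Notation h := (kmw_h F).
Local Notation rho := (@kmw_sym F (fx_m1 F)).

Section PrimeData.
Variable J : set (KMW F).
Hypothesis prJ : prime_ideal J.

Let idJ : two_sided_ideal J := prime_ideal_ideal prJ.

Lemma prime_symM a b : J (sym a) -> J (sym b) -> J (sym (fx_mul a b)).
Proof.
move=> Ja Jb; rewrite kmw_symM; apply: (ideal_add idJ (ideal_add idJ Ja Jb)).
exact: (ideal_mulL idJ).
Qed.

Lemma prime_symV a : J (sym a) -> J (sym (fx_inv a)).
Proof.
move=> Ja; have := kmw_symM a (fx_inv a); rewrite fx_mulV kmw_sym1 => E.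
have J1 : J (sym a + eta * sym a * sym (fx_inv a)).
  by apply: (ideal_add idJ Ja); apply: (ideal_mulR idJ); apply: (ideal_mulL idJ).
suff -> : sym (fx_inv a) = - (sym a + eta * sym a * sym (fx_inv a)).
  exact: (ideal_opp idJ J1).
by apply/eqP; rewrite -addr_eq0 addrA [sym _ + sym a]addrC -E.
Qed.

Lemma prime_sym_opp a : J (sym a) \/ J (sym (fx_opp a)).
Proof. by apply: (prime_idealM prJ); rewrite kmw_sym_opp; exact: (ideal_zero idJ). Qed.

Lemma prime_rho_symbols : J rho -> symbols setT `<=` J.
Proof.
move=> Jr _ [a _ <-]; have [//|Jn] := prime_sym_opp a.
by rewrite -(fx_opp_opp a); apply: prime_symM.
Qed.

Lemma prime_h_or_eta : J h \/ J eta.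
Proof. by apply: (prime_idealM prJ); rewrite kmw_h_eta; exact: (ideal_zero idJ). Qed.

Lemma prime_eta_h : J eta -> J h <-> J 2%:R.
Proof.
move=> Je; apply: (ideal_cong idJ); rewrite /kmw_h addrC addKr.
exact: (ideal_mulR idJ).
Qed.

Lemma prime_rho_h : J rho -> J h <-> J 2%:R.
Proof.
move=> Jr; apply: (ideal_cong idJ); rewrite /kmw_h addrC addKr.
exact: (ideal_mulL idJ).
Qed.

(** Because rho h = [1] = 0. *)
Lemma prime_not_rho_h : ~ J rho -> J h.
Proof.
move=> nr; have : J (rho * h) by rewrite kmw_h_rho; exact: (ideal_zero idJ).
by case/(prime_idealM prJ).
Qed.

Lemma prime_2_dvd (p : nat) : (forall c : int, J c%:~R <-> (p %| c)%Z) -> J 2%:R ->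
  prime p -> p = 2%N.
Proof. by move=> Jp /(Jp 2) + p_pr; rewrite dvdzE /= dvdn_prime2 // => /eqP. Qed.

Definition prime_signs (a : Fx F) : bool := ~~ `[< J (sym a) >].

Lemma prime_signsP a : prime_signs a = false <-> J (sym a).
Proof. by split=> [/negbFE/asboolP//|Ja]; apply/negbTE; rewrite negbK; apply/asboolP. Qed.

(** Sums: for c = a + b with a, b positive, (a/c) + (b/c) = 1 makes a/c or b/c
    positive, hence c.  That c is nonzero follows from the sign of -1. *)
Lemma prime_signs_ordering : ~ J rho -> is_ordering prime_signs.
Proof.
move=> nr.
have m1 : prime_signs (fx_m1 F) = true.
  by case E: (prime_signs _) => //; move/prime_signsP: E.
have opp_pos a : prime_signs a = true -> prime_signs (fx_opp a) = false.
  move=> na; apply/prime_signsP; case: (prime_sym_opp a) => // Ja.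
  by rewrite ((prime_signsP a).2 Ja) in na.
have pos_mul a b : prime_signs a = false -> prime_signs b = false ->
    prime_signs (fx_mul a b) = false.
  by move=> /prime_signsP Ja /prime_signsP Jb; apply/prime_signsP/prime_symM.
have pos_inv a : prime_signs a = false -> prime_signs (fx_inv a) = false.
  by move=> /prime_signsP Ja; apply/prime_signsP/prime_symV.
have neg_mul a b : prime_signs a = true -> prime_signs b = false ->
    prime_signs (fx_mul a b) = true.
  move=> na pb; case pab: (prime_signs (fx_mul a b)) => //.
  by rewrite -(fx_mulK b a) pos_mul ?pos_inv // in na.
split.
- apply/seteqP; split=> // -[] _; first by exists (fx_m1 F).
  by exists (fx1 F) => //; apply/prime_signsP; rewrite kmw_sym1; exact: (ideal_zero idJ).
- move=> a b; case pa: (prime_signs a); case pb: (prime_signs b).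
  + have -> : fx_mul a b = fx_mul (fx_opp a) (fx_opp b).
      by apply: fx_val_inj; rewrite /= !mulN1r mulrNN.
    exact: pos_mul (opp_pos _ pa) (opp_pos _ pb).
  + exact: neg_mul.
  + by rewrite fx_mulC neg_mul.
  + exact: pos_mul.
- move=> a b pa pb.
  have nz : sval a + sval b != 0.
    apply/eqP => ab0; have E : b = fx_opp a.
      by apply: fx_val_inj; rewrite /= mulN1r; apply/eqP; rewrite -addr_eq0 addrC ab0.
    by rewrite E /fx_opp neg_mul in pb.
  exists nz; set c := mkFx nz.
  have cE x : fx_mul x (fx_inv (fx_mul x (fx_inv c))) = c.
    apply: fx_val_inj; rewrite /= invfM invrK mulrA divff ?mul1r //; exact: svalP x.
  have st : sval (fx_mul a (fx_inv c)) + sval (fx_mul b (fx_inv c)) = 1.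
    by rewrite /= -mulrDl divff.
  have : J (sym (fx_mul a (fx_inv c)) * sym (fx_mul b (fx_inv c))).
    by rewrite kmw_steinberg //; exact: (ideal_zero idJ).
  case/(prime_idealM prJ) => /prime_signsP/pos_inv pV.
    by rewrite -(cE a) pos_mul.
  by rewrite -(cE b) pos_mul.
Qed.

End PrimeData.

Lemma spech_homog_prime_eq (S J : set (KMW F)) : spech F J -> S `<=` J ->
    graded_cyclic (ideal_gen S) ->
    (forall c : int, J c%:~R -> ideal_gen S c%:~R) ->
    (J rho -> ideal_gen S rho) -> (J eta -> ideal_gen S eta) ->
  J = ideal_gen S.
Proof.
move=> [prJ homJ] SJ rS; apply: (homog_prime_eq rS) => //.
exact: (ideal_gen_min (prime_ideal_ideal prJ) SJ).
Qed.

Lemma graded_cyclic_gen_ordered alpha (X : set (KMW F)) : is_ordering alpha ->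
  let I := ideal_gen (symbols (pos_cone alpha) `|` X) in I h -> graded_cyclic I.
Proof.
move=> ord I Ih; apply: (graded_cyclic_ordered ord) => //; first exact: ideal_gen_ideal.
by move=> x Px; apply: sub_ideal_gen; left.
Qed.

Lemma graded_cyclic_gen_full (X : set (KMW F)) :
  graded_cyclic (ideal_gen (symbols [set: Fx F] `|` X)).
Proof.
apply: graded_cyclic_full; first exact: ideal_gen_ideal.
by move=> x Px; apply: sub_ideal_gen; left.
Qed.

(** The cases are: rho in J or not, then eta in J or not, then the prime number in
    J if any.  If eta is not in J, then h is; with rho in J this gives 2 in J, and
    with rho not in J it excludes 2, since then eta rho would be in J. *)
Theorem spech_classification J : spech F J ->
  [\/ spech_A F J, spech_B F J, spech_C F J |
      spech_D F J \/ [set ideal_2 F; ideal_eta F; ideal_2_eta F] J].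
Proof.
move=> spJ; have [prJ _] := spJ; have idJ := prime_ideal_ideal prJ.
have gen (S X : set (KMW F)) x : X x -> ideal_gen (S `|` X) x.
  by move=> Xx; apply: sub_ideal_gen; right.
have gen_dvdz S (X : set (KMW F)) p : (X p%:R : Prop) ->
    (forall c : int, J c%:~R <-> (p %| c)%Z) ->
    forall c : int, J c%:~R -> ideal_gen (S `|` X) c%:~R.
  move=> Xp Jp c /Jp; apply: ideal_dvdz; [exact: ideal_gen_ideal|exact: gen].
have gen0 (S : set (KMW F)) : (forall c : int, J c%:~R -> c = 0) ->
    forall c : int, J c%:~R -> ideal_gen S c%:~R.
  by move=> J0 c /J0 ->; apply: ideal_zero; exact: ideal_gen_ideal.
have char2 : J 2%:R -> forall c : int, J c%:~R <-> (2 %| c)%Z.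
  move=> J2; have [J0|[p p_pr Jp]] := prime_ideal_char prJ; first by have := J0 2 J2.
  by have p2 := prime_2_dvd Jp J2 p_pr; rewrite p2 in Jp.
have odd_char p : prime p -> (forall c : int, J c%:~R <-> (p %| c)%Z) ->
    ~ J 2%:R -> odd p.
  move=> p_pr Jp n2; have [p2|//] := even_prime p_pr; case: n2.
  by apply/(Jp 2); rewrite p2.
have JofP (p : nat) : (forall c : int, J c%:~R <-> (p %| c)%Z) -> J p%:R.
  by move=> Jp; apply/(Jp p); rewrite dvdzz.
have [Jr|nr] := pselect (J rho).
  have SJ := prime_rho_symbols prJ Jr.
  have rhoS X : ideal_gen (symbols [set: Fx F] `|` X) rho.
    by apply: sub_ideal_gen; left; exists (fx_m1 F).
  apply: Or44; have [Je|ne] := pselect (J eta).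
    have [J2|n2] := pselect (J 2%:R).
      right; right; apply: spech_homog_prime_eq => //.
      + by move=> x [/SJ//|[->|->]].
      + exact: graded_cyclic_gen_full.
      + by apply: (gen_dvdz _ _ 2%N); [left|exact: char2].
      + by move=> _; apply: gen; right.
    have [J0|[p p_pr Jp]] := prime_ideal_char prJ.
      right; left; right; apply: spech_homog_prime_eq => //.
      + by move=> x [/SJ//|->].
      + exact: graded_cyclic_gen_full.
      + exact: gen0.
      + by move=> _; exact: gen.
    left; exists p; split=> //; first exact: odd_char Jp n2.
    apply: spech_homog_prime_eq => //.
    + by move=> x [/SJ//|[->|->]] //; exact: JofP.
    + exact: graded_cyclic_gen_full.
    + by apply: (gen_dvdz _ _ p) => //; right.
    + by move=> _; apply: gen; left.
  have J2 : J 2%:R by apply/(prime_rho_h prJ Jr); case: (prime_h_or_eta prJ).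
  right; left; left; apply: spech_homog_prime_eq => //.
  + by move=> x [/SJ//|->].
  + exact: graded_cyclic_gen_full.
  + by apply: (gen_dvdz _ _ 2%N) => //; exact: char2.
have ord := prime_signs_ordering prJ nr; have Jh := prime_not_rho_h prJ nr.
have PJ : symbols (pos_cone (prime_signs J)) `<=` J.
  by move=> _ [a /(prime_signsP J)//  Ja <-].
have [Je|ne] := pselect (J eta).
  have J2 : J 2%:R by apply/(prime_eta_h prJ Je).
  apply: Or42; exists (prime_signs J) => //; apply: spech_homog_prime_eq => //.
  + by move=> x [/PJ//|[->|->]].
  + by apply: graded_cyclic_gen_ordered => //; exact: ideal_B_h.
  + by apply: (gen_dvdz _ _ 2%N); [left|exact: char2].
  + by move=> _; apply: gen; right.
have n2 : ~ J 2%:R.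
  move=> J2; have : J (eta * rho).
    rewrite -[_ * _](addKr 2%:R); apply: (ideal_add idJ) => //; exact: ideal_opp.
  by case/(prime_idealM prJ).
have [J0|[p p_pr Jp]] := prime_ideal_char prJ.
  apply: Or41; exists (prime_signs J) => //; apply: spech_homog_prime_eq => //.
  + by move=> x [/PJ//|->].
  + by apply: graded_cyclic_gen_ordered => //; exact: gen.
  + exact: gen0.
apply: Or43; exists (prime_signs J), p; split=> //; first exact: odd_char Jp n2.
apply: spech_homog_prime_eq => //.
+ by move=> x [/PJ//|[->|->]] //; exact: JofP.
+ by apply: graded_cyclic_gen_ordered => //; apply: gen; left.
+ by apply: (gen_dvdz _ _ p) => //; right.
Qed.

End Classification.

(** * Separation of the families *)

Section Invariants.
Variable F : fieldType.
Local Notation eta := (kmw_eta F).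
Local Notation rho := (@kmw_sym F (fx_m1 F)).

Lemma ideal_A_spech alpha : is_ordering alpha -> spech F (ideal_A alpha).
Proof.
move=> ord; apply: kernel_spech (ideal_A_kernel ord).
by move=> x [/symbols_homogeneous//|->]; exact: homogeneous_h.
Qed.

Lemma ideal_B_spech alpha : is_ordering alpha -> spech F (ideal_B alpha).
Proof.
move=> ord; apply: kernel_spech (ideal_B_kernel ord).
move=> x [/symbols_homogeneous//|[->|->]]; first exact: homogeneous_nat.
exact: homogeneous_eta.
Qed.

Lemma ideal_C_spech alpha p : is_ordering alpha -> prime p -> odd p ->
  spech F (ideal_C alpha p).
Proof.
move=> ord p_pr p_odd.
apply: (kernel_spech _ (fun x => ideal_C_kernel ord x p_pr p_odd)).
move=> x [/symbols_homogeneous//|[->|->]]; first exact: homogeneous_h.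
exact: homogeneous_nat.
Qed.

Lemma ideal_D_spech p : prime p -> spech F (@ideal_D F p).
Proof.
move=> p_pr; apply: (kernel_spech _ (fun x => ideal_D_kernel x p_pr)).
move=> x [/symbols_homogeneous//|[->|->]]; first exact: homogeneous_eta.
exact: homogeneous_nat.
Qed.

Lemma ideal_2_spech : spech F (ideal_2 F).
Proof.
apply: kernel_spech (@ideal_2_kernel F).
by move=> x [/symbols_homogeneous//|->]; exact: homogeneous_nat.
Qed.

Lemma ideal_eta_spech : spech F (ideal_eta F).
Proof.
apply: kernel_spech (@ideal_eta_kernel F).
by move=> x [/symbols_homogeneous//|->]; exact: homogeneous_eta.
Qed.

Lemma ideal_2_eta_spech : spech F (ideal_2_eta F).
Proof.
apply: kernel_spech (@ideal_2_eta_kernel F).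
move=> x [/symbols_homogeneous//|[->|->]]; first exact: homogeneous_nat.
exact: homogeneous_eta.
Qed.

(** An odd number and 2 generate the unit ideal. *)
Lemma prime_ideal_2_odd (J : set (KMW F)) p :
  prime_ideal J -> odd p -> J p%:R -> ~ J 2%:R.
Proof.
move=> prJ p_odd Jp J2; apply: (prime_ideal1 prJ).
have idJ := prime_ideal_ideal prJ.
have -> : 1 = p%:R - (p./2)%:R * 2%:R :> KMW F.
  by rewrite -[in p%:R](odd_double_half p) p_odd natrD -muln2 natrM addrK.
by apply: ideal_sub => //; apply: ideal_mulL.
Qed.

Lemma spech_A_invariants J : spech_A F J ->
  [/\ ~ J rho, ~ J eta & forall p, prime p -> ~ J p%:R].
Proof.
move=> [alpha ord ->]; split=> [||p p_pr] /(ideal_A_kernel ord).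
- by move/kmw_eval_sym_eq0/eqP; rewrite /= ordering_m1 // oner_eq0.
- by move/kmw_eval_eta_eq0/eqP; rewrite /= oppr_eq0 pnatr_eq0.
- by move/kmw_eval_nat_eq0/eqP; rewrite pnatr_eq0 => /eqP p0; rewrite p0 in p_pr.
Qed.

Lemma spech_B_invariants J : spech_B F J -> ~ J rho /\ J eta.
Proof.
move=> [alpha ord ->]; split; last by apply: sub_ideal_gen; right; right.
move=> /(ideal_B_kernel ord)/kmw_eval_sym_eq0/eqP.
by rewrite /= ordering_m1 // oner_eq0.
Qed.

Lemma spech_C_invariants J : spech_C F J ->
  [/\ ~ J rho, ~ J eta & exists2 p, prime p & J p%:R].
Proof.
move=> [alpha [p [ord p_pr p_odd ->]]]; split.
- move=> /(ideal_C_kernel ord _ p_pr p_odd)/kmw_eval_sym_eq0/eqP.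
  by rewrite /= ordering_m1 // oner_eq0.
- move=> /(ideal_C_kernel ord _ p_pr p_odd)/kmw_eval_eta_eq0/eqP.
  by rewrite /= oppr_eq0 (negPf (Fp2_eq0 p_pr p_odd)).
- by exists p => //; apply: sub_ideal_gen; right; right.
Qed.

Lemma ideal_full_rho (X : set (KMW F)) : ideal_gen (symbols [set: Fx F] `|` X) rho.
Proof. by apply: sub_ideal_gen; left; exists (fx_m1 F). Qed.

Lemma spech_D_invariants J : spech_D F J ->
  [/\ J rho, J eta, ~ J 2%:R & exists2 p, prime p & J p%:R].
Proof.
move=> [p [p_pr p_odd ->]].
have Jp : @ideal_D F p p%:R by apply: sub_ideal_gen; right; right.
split; first exact: ideal_full_rho.
- by apply: sub_ideal_gen; right; left.
- by apply: prime_ideal_2_odd p_odd Jp; case: (ideal_D_spech p_pr).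
- by exists p.
Qed.

Lemma eta_notin_ideal_2 : ~ ideal_2 F eta.
Proof. by move=> /ideal_2_kernel/kmw_eval_eta_eq0/eqP; rewrite oner_eq0. Qed.

Lemma primes_notin_ideal_eta p : prime p -> ~ ideal_eta F p%:R.
Proof.
move=> p_pr /ideal_eta_kernel/kmw_eval_nat_eq0/eqP; rewrite pnatr_eq0.
by move=> /eqP p0; rewrite p0 in p_pr.
Qed.

Lemma three_points_invariants J :
  [set ideal_2 F; ideal_eta F; ideal_2_eta F] J ->
  J rho /\ [\/ ~ J eta, forall p, prime p -> ~ J p%:R | J 2%:R].
Proof.
move=> [[]->|->]; (split; first exact: ideal_full_rho).
- by apply: Or31; exact: eta_notin_ideal_2.
- by apply: Or32; exact: primes_notin_ideal_eta.
- by apply: Or33; apply: sub_ideal_gen; right; left.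
Qed.

End Invariants.

Theorem theorem2p4 (F : fieldType) (charF : 2%N \notin [pchar F]) :
  [/\ is_disjoint_union (spech F)
        [:: spech_A F; spech_B F; spech_C F; spech_D F;
            [set ideal_2 F; ideal_eta F; ideal_2_eta F]],
      [/\ ideal_2 F <> ideal_eta F, ideal_2 F <> ideal_2_eta F &
          ideal_eta F <> ideal_2_eta F],
      homeomorphic (subspech (spech_A F)) (subspech (spech_B F)) &
      homeomorphic (subspech (spech_B F)) (X_ F)].
Proof.
have eta_eta : ideal_eta F (kmw_eta F) by apply: sub_ideal_gen; right.
have eta_2_eta : ideal_2_eta F (kmw_eta F) by apply: sub_ideal_gen; right; right.
have two_2_eta : ideal_2_eta F 2%:R by apply: sub_ideal_gen; right; left.
have [AX _] := ordering_family_homeomorphic (@ideal_A_kernel F) (@ideal_A_spech F)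
  (fun J => iff_refl (spech_A F J)).
have [BX XB] := ordering_family_homeomorphic (@ideal_B_kernel F) (@ideal_B_spech F)
  (fun J => iff_refl (spech_B F J)).
split; [split| |exact: homeomorphic_trans AX XB|exact: BX].
- apply/seteqP; split=> [J /spech_classification[|||[]] Ji|J [i /= _]].
  + by exists 0%N.
  + by exists 1%N.
  + by exists 2%N.
  + by exists 3%N.
  + by exists 4%N.
  case: i => [|[|[|[|[|i]]]]] /=; rewrite ?nth_nil //.
  + by move=> [alpha ord ->]; exact: ideal_A_spech.
  + by move=> [alpha ord ->]; exact: ideal_B_spech.
  + by move=> [alpha [p [ord p_pr p_odd ->]]]; exact: ideal_C_spech.
  + by move=> [p [p_pr _ ->]]; exact: ideal_D_spech.
  + move=> [[]->|->]; [exact: ideal_2_spech|exact: ideal_eta_spech|].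
    exact: ideal_2_eta_spech.
- apply/trivIsetP => i j; wlog ij : i j / (i < j)%N.
    move=> H di dj; rewrite neq_ltn => /orP[ij|ji]; first by apply: H; rewrite // ltn_eqF.
    by rewrite setIC; apply: H; rewrite // ltn_eqF.
  move=> _ /= jn _; rewrite -subset0 => J [].
  case: j ij jn => [|[|[|[|[|j]]]]] //; case: i => [|[|[|[|i]]]] //= _ _.
  + by move=> /spech_A_invariants[_ nA _] /spech_B_invariants[_ /nA].
  + by move=> /spech_A_invariants[_ _ nA] /spech_C_invariants[_ _ [p /nA]].
  + by move=> /spech_B_invariants[_ Be] /spech_C_invariants[_ /(_ Be)].
  + by move=> /spech_A_invariants[nA _ _] /spech_D_invariants[/nA].
  + by move=> /spech_B_invariants[nB _] /spech_D_invariants[/nB].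
  + by move=> /spech_C_invariants[nC _ _] /spech_D_invariants[/nC].
  + by move=> /spech_A_invariants[nA _ _] /three_points_invariants[/nA].
  + by move=> /spech_B_invariants[nB _] /three_points_invariants[/nB].
  + by move=> /spech_C_invariants[nC _ _] /three_points_invariants[/nC].
  + move=> /spech_D_invariants[_ De D2 [p p_pr Dp]] /three_points_invariants[_].
    by case=> [/(_ De)|/(_ p p_pr)/(_ Dp)|/D2].
- split=> E.
  + by apply: (@eta_notin_ideal_2 F); rewrite E.
  + by apply: (@eta_notin_ideal_2 F); rewrite E.
  + by apply: (@primes_notin_ideal_eta F 2%N) => //; rewrite E.
Qed.
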